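(* Let $\alpha,\beta>0$ be rationally independent real numbers. Consider measurable functions $f:\mathbb{R}\to\mathbb{C}$ satisfying $$\sum_{k\in\mathbb{Z}} f(x-k\alpha)=1,\qquad \sum_{k\in\mathbb{Z}} f(x-k\beta)=0\qquad\text{for a.e. } x\in\mathbb{R},\qquad( * )$$ where both series converge absolutely for a.e. $x$. For any $\varepsilon>0$ there is a measurable function $f$ satisfying $( * )$ such that $\operatorname{mes}(\operatorname{supp} f)<\alpha+\varepsilon$. Conversely, any measurable $f$ satisfying $( * )$ must have $\operatorname{mes}(\operatorname{supp} f)>\alpha$.
   Context: Two positive real numbers $\alpha,\beta$ are rationally independent if $n\alpha+m\beta=0$ with $n,m\in\mathbb{Z}$ implies $n=m=0$ (equivalently, $\alpha/\beta$ is irrational). The support of a function $f$ is the set $\operatorname{supp} f=\{x: f(x)\ne 0\}$ (no closure is taken). $\operatorname{mes}$ denotes Lebesgue measure on $\mathbb{R}$. *)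

(* Defs.v *)
From mathcomp Require Export all_boot all_order all_algebra complex.
From mathcomp Require Export all_classical all_reals all_analysis.

Set Implicit Arguments.
Unset Strict Implicit.
Unset Printing Implicit Defensive.

Import Order.TTheory GRing.Theory Num.Theory.
Import numFieldNormedType.Exports.

Local Open Scope classical_set_scope.
Local Open Scope ring_scope.
Local Open Scope complex_scope.

Section Defs.
Context {R : realType}.

(* R with the sigma-algebra of all Lebesgue measurable sets, the domain of
   [completed_lebesgue_measure]; the default structure on R is Borel. *)
Definition lebesgueTypeR := caratheodory_type (@wlength R idfun)^*%mu.

(* C with its Borel sigma-algebra. The library puts the topology of the
   modulus on [R[i]^o]. *)
Definition borelTypeC := g_sigma_algebraType (@open R[i]^o).

Definition lebesgue_measurable (f : R -> R[i]) : Prop :=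
  measurable_fun [set: lebesgueTypeR] (f : lebesgueTypeR -> borelTypeC).

Definition mes (A : set R) : \bar R := completed_lebesgue_measure A.

Definition ae (P : R -> Prop) : Prop :=
  {ae @completed_lebesgue_measure R, forall x, P x}.

Definition supp (f : R -> R[i]) : set R := [set x | f x != 0].

Definition rationally_independent (a b : R) : Prop :=
  forall n m : int, n%:~R * a + m%:~R * b = 0 -> n = 0 /\ m = 0.

Definition zseries_abs_cvg (u : int -> R[i]) : Prop :=
  summable [set: int] (fun k => (ComplexField.Normc.normc (u k))%:E).

(* The halves k >= 0 and k < 0 converge separately ([Negz n] is - n.+1). *)
Definition zseries_cvg_to (u : int -> R[i]) (s : R[i]) : Prop :=
  exists s1 s2 : R[i],
    [/\ series (fun n => u (Posz n) : R[i]^o) @ \oo --> (s1 : R[i]^o),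
        series (fun n => u (Negz n) : R[i]^o) @ \oo --> (s2 : R[i]^o)
      & s = s1 + s2].

(* For a.e. x, the sum of f (x - k * a) over k in Z converges absolutely,
   with value s. *)
Definition tiles_at_level (f : R -> R[i]) (a : R) (s : R[i]) : Prop :=
  ae (fun x => zseries_abs_cvg (fun k => f (x - k%:~R * a))) /\
  ae (fun x => zseries_cvg_to (fun k => f (x - k%:~R * a)) s).

End Defs.

(* Main.v *)
Require Import Defs.
From mathcomp Require Import lra zify measurable_realfun.
Import Order.TTheory GRing.Theory Num.Theory.
Import numFieldNormedType.Exports.

(* Lower bound. The translates of S = supp f by alpha Z cover almost all of R.
   If mes S <= alpha they are almost disjoint as well, so f = 1 a.e. on S; the
   sum over beta Z is then a number of points, and being 0 it forces f = 0 a.e.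

   Construction. Let u x be the residue of x modulo alpha, fix a small c > 0,
   and let rho x be the first j >= 1 with u (x + j beta) < u x if u x < c, and
   rho x = 1 otherwise. Let E be the set of points b + k beta with 0 <= b < c
   such that k is the first j >= 1 with u (b + (k - j) beta) < min (u x) c,
   where x = b + k beta. Modulo alpha, E is a fundamental domain, and
     f = rho 1_E - (rho - 1) 1_[0, c)
   has support of measure at most alpha + c and sum rho - (rho - 1) = 1 over
   alpha Z. Over beta Z only the orbits of the b in [0, c) matter: on such an
   orbit, E consists of the k < rho b that are records of min (u (b + k beta)) c
   (k >= 1), consecutive records differ by rho, so the sum of rho over E
   telescopes to rho b - 1. *)

Set Implicit Arguments.
Unset Strict Implicit.
Unset Printing Implicit Defensive.
Local Open Scope classical_set_scope.
Local Open Scope ring_scope.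
Local Open Scope complex_scope.

(** * Lebesgue measure *)

Section LebesgueTranslation.
Context {R : realType}.
Implicit Types (A S : set R) (t : R).

Definition translate t A : set R := [set x | A (x + t)].

(** [mes] is an outer measure defined through covers by half-open intervals. Translating a cover
    keeps all lengths, which settles arbitrary sets. *)
Lemma mes_translate_le A t : (mes (translate t A) <= mes A)%E.
Proof.
have tr_itv a b : translate t `]a, b] = `](a - t), (b - t)]%classic.
  by apply/seteqP; split => x; rewrite /translate /= !in_itv /= ltrBlDr lerBrDr.
apply: ereal_inf_le_tmp => _ [F [mF AF] <-].
exists (fun k => translate t (F k)); first split.
- by move=> k; have [[a b] _ <-] := mF k; exists (a - t, b - t).
- by move=> x /AF [k _ Fk]; exists k.
apply: eq_eseriesr => k _; have [[a b] _ /= <-] := mF k.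
rewrite tr_itv (wlength_itv idfun `](a - t), (b - t)]) (wlength_itv idfun `]a, b]) /=.
rewrite !lte_fin ltrD2r.
by case: ifP => // _; rewrite -!EFinD opprD opprK addrACA addNr addr0.
Qed.

Lemma mes_translate A t : mes (translate t A) = mes A.
Proof.
apply/eqP; rewrite eq_le mes_translate_le /=.
have := mes_translate_le (translate t A) (- t).
by congr (mes _ <= _)%E; apply/seteqP; split => x; rewrite /translate /= subrK.
Qed.

(** The Caratheodory criterion for the translate, tested on X, becomes the criterion for A tested on
    X shifted back. *)
Lemma measurable_translate A t : measurable (A : set (@lebesgueTypeR R)) ->
  measurable (translate t A : set (@lebesgueTypeR R)).
Proof.
move=> mA; change (caratheodory_measurable (@mes R) (translate t A)) => X.
have sh Y : mes Y = mes (translate (- t) Y) by rewrite mes_translate.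
have trK : translate (- t) (translate t A) = A.
  by apply/seteqP; split => x; rewrite /translate /= subrK.
have trI : translate (- t) (X `&` translate t A) = translate (- t) X `&` A.
  by rewrite -[in RHS]trK.
have trD : translate (- t) (X `&` ~` translate t A) = translate (- t) X `&` ~` A.
  by rewrite -[in RHS]trK.
rewrite sh [X in (X + _)%E]sh [X in (_ + X)%E]sh trI trD.
exact: (mA : caratheodory_measurable (@mes R) A).
Qed.

End LebesgueTranslation.

(** An enumeration of Z, so that unions and series indexed by [nat] can run over all integer
    translates. *)
Definition int_of_nat (n : nat) : int := if odd n then Negz n./2 else Posz n./2.
Definition nat_of_int (z : int) : nat :=
  match z with Posz n => n.*2 | Negz n => n.*2.+1 end.

Lemma int_of_natK : cancel int_of_nat nat_of_int.
Proof.
move=> n; rewrite /int_of_nat; have e := odd_double_half n.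
by case: ifP => on /=; rewrite -[RHS]e on.
Qed.

Lemma nat_of_intK : cancel nat_of_int int_of_nat.
Proof.
by case=> n; rewrite /int_of_nat /= odd_double /= ?doubleK // uphalf_double.
Qed.

Section LebesgueFold.
Context {R : realType}.
Implicit Types (A S : set R) (a t x : R).

Lemma lebesgue_measurable_borel A : measurable (A : set (measurableTypeR R)) ->
  measurable (A : set (@lebesgueTypeR R)).
Proof. exact: sub_caratheodory. Qed.

Lemma mes_itv0 a : 0 < a -> mes (`[0, a[ : set R) = a%:E.
Proof.
move=> a0; rewrite (_ : mes _ = lebesgue_measure (`[0, a[ : set R)) //.
by rewrite lebesgue_measure_itv /= lte_fin a0 oppr0 adde0.
Qed.

Lemma negligible_countable A : countable A ->
  (@completed_lebesgue_measure R).-negligible A.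
Proof.
move=> cA; exists A; split => //; last exact: countable_lebesgue_measure0.
by apply: lebesgue_measurable_borel; exact: countable_measurable.
Qed.

End LebesgueFold.

(** * Residues modulo a and folding of the line onto [0, a) *)

Section Residue.
Context {R : realType}.
Implicit Types (a x : R) (z : int).

Definition quo a x : int := Num.floor (x / a).
Definition residue a x : R := x - (quo a x)%:~R * a.

Lemma quo_residue a x : x = residue a x + (quo a x)%:~R * a.
Proof. by rewrite subrK. Qed.

Lemma quoD a x z : 0 < a -> quo a (x + z%:~R * a) = quo a x + z.
Proof.
by move=> a0; rewrite /quo mulrDl mulfK ?gt_eqF // floorDrz ?intr_int // intrKfloor.
Qed.

Lemma residueD a x z : 0 < a -> residue a (x + z%:~R * a) = residue a x.
Proof.
by move=> a0; rewrite /residue quoD // rmorphD mulrDl opprD addrACA subrr addr0.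
Qed.

Lemma residue_ge0 a x : 0 < a -> 0 <= residue a x.
Proof.
by move=> a0; rewrite subr_ge0 -ler_pdivlMr // floor_le.
Qed.

Lemma residue_lt a x : 0 < a -> residue a x < a.
Proof.
move=> a0; rewrite ltrBlDr -[X in X + _]mul1r -mulrDl -ltr_pdivrMr // addrC.
by have := floorD1_gt (x / a); rewrite intrD.
Qed.

Lemma quo_eq0 a x : 0 < a -> 0 <= x < a -> quo a x = 0.
Proof.
move=> a0 /andP[x0 xa]; apply: floor_def.
by rewrite divr_ge0 // ?ltW //= ltr_pdivrMr // mul1r.
Qed.

Lemma residue_id a x : 0 < a -> 0 <= x < a -> residue a x = x.
Proof. by move=> a0 xa; rewrite /residue quo_eq0 // mul0r subr0. Qed.


Lemma measurable_quo_eq a z : 0 < a ->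
  measurable ([set x | quo a x = z] : set (measurableTypeR R)).
Proof.
move=> a0; rewrite (_ : [set x | _] = `[z%:~R * a, (z + 1)%:~R * a[%classic).
  exact: measurable_itv.
apply/seteqP; split => x /=; rewrite in_itv /= -ler_pdivlMr // -ltr_pdivrMr //.
  by move=> <-; exact: floor_itv.
exact: floor_def.
Qed.

Lemma measurable_residue a : 0 < a ->
  measurable_fun setT (residue a : measurableTypeR R -> measurableTypeR R).
Proof.
move=> a0; rewrite (_ : setT = \bigcup_n [set x | quo a x = int_of_nat n]).
  apply/measurable_fun_bigcup => n; first exact: measurable_quo_eq.
  apply: (@eq_measurable_fun _ _ _ _ _ (fun x => x - (int_of_nat n)%:~R * a)).
    by move=> x; rewrite inE /= /residue => ->.
  by apply: (@measurable_funB _ _ _ _ id); [exact: measurable_id|exact: measurable_cst].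
apply/seteqP; split => x //= _; exists (nat_of_int (quo a x)) => //=.
by rewrite nat_of_intK.
Qed.

(** S is cut along the cells [z a, (z + 1) a), and each piece is moved back to [0, a). *)
Lemma mes_fold a S : 0 < a -> measurable (S : set (@lebesgueTypeR R)) ->
  mes S = (\sum_(n <oo) mes (translate ((int_of_nat n)%:~R * a) S `&` `[0%R, a[))%E.
Proof.
move=> a0 mS; pose I n := [set x | quo a x = int_of_nat n].
have trI n : translate ((int_of_nat n)%:~R * a) (S `&` I n) =
    translate ((int_of_nat n)%:~R * a) S `&` `[0, a[.
  apply/seteqP; split => x; rewrite /translate /I /= in_itv /= quoD // => -[Sx].
    rewrite -[RHS]add0r => /addIr q0; split => //.
    rewrite [x](quo_residue a) q0 mul0r addr0.
    by rewrite residue_ge0 //= residue_lt.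
  by move=> xa; rewrite quo_eq0 ?add0r.
transitivity (mes (\bigcup_n (S `&` I n))).
  congr (mes _); apply/seteqP; split => [x Sx|x [n _ []]//].
  by exists (nat_of_int (quo a x)) => //; split; rewrite /I //= nat_of_intK.
have mI n : measurable (S `&` I n : set (@lebesgueTypeR R)).
  apply: measurableI => //; apply: lebesgue_measurable_borel.
  exact: measurable_quo_eq.
transitivity (\sum_(n <oo) mes (S `&` I n))%E.
  apply: (measure_semi_bigcup (@completed_lebesgue_measure R)) => //.
    apply/trivIsetP => i j _ _ ij; apply/seteqP; split => // x [[_ xi] [_ xj]].
    by move: ij; rewrite -(inj_eq (can_inj int_of_natK)) -xi -xj eqxx.
  exact: bigcupT_measurable.
by apply: eq_eseriesr => n _; rewrite -trI mes_translate.
Qed.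

End Residue.

(** * Series indexed by the integers *)

Section ZSeries.
Context {R : realType}.
Implicit Types (u v : int -> R[i]) (s t : R[i]) (w : nat -> R[i]).

Lemma series_finite_support w n : (forall k, (n <= k)%N -> w k = 0) ->
  series (w : nat -> R[i]^o) @ \oo --> (\sum_(0 <= k < n) w k : R[i]^o).
Proof.
move=> w0; apply: cvg_near_cst; exists n => // m /= nm.
rewrite /series /= (@big_cat_nat _ _ _ n) //= [X in _ + X]big1_seq ?addr0 // => k.
by rewrite mem_index_iota => /andP[_ /andP[+ _]]; exact: w0.
Qed.

Lemma zseries_cvg_delta (k0 : int) s :
  zseries_cvg_to (fun k => if k == k0 then s else 0) s.
Proof.
have e n (z : R[i]) : \sum_(0 <= k < n.+1) (if k == n then z else 0) = z.
  rewrite big_nat_recr //= eqxx big1_seq ?add0r // => k.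
  by rewrite mem_index_iota => /andP[_ /andP[_ kn]]; rewrite ltn_eqF.
have z0 w : (forall k, w k = 0) -> series (w : nat -> R[i]^o) @ \oo --> (0 : R[i]^o).
  move=> w0; have := @series_finite_support w 0%N (fun k _ => w0 k).
  by rewrite big_geq.
have zs n : series ((fun k => if k == n then s else 0) : nat -> R[i]^o) @ \oo
    --> (s : R[i]^o).
  have := @series_finite_support (fun k => if k == n then s else 0) n.+1.
  by rewrite e; apply => k; case: eqP => // ->; rewrite ltnn.
case: k0 => n; [exists s, 0|exists 0, s]; split; rewrite ?addr0 ?add0r //.
- exact: zs.
- exact: z0.
- exact: z0.
- exact: zs.
Qed.

Lemma zseries_cvgD u v s t : zseries_cvg_to u s -> zseries_cvg_to v t ->
  zseries_cvg_to (fun k => u k + v k) (s + t).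
Proof.
move=> [s1 [s2 [us1 us2 ->]]] [t1 [t2 [vt1 vt2 ->]]].
exists (s1 + t1), (s2 + t2); split; last by rewrite addrACA.
- rewrite (seriesD (fun n => u (Posz n)) (fun n => v (Posz n))).
  exact: (cvgD us1 vt1).
- rewrite (seriesD (fun n => u (Negz n)) (fun n => v (Negz n))).
  exact: (cvgD us2 vt2).
Qed.

(** Induction on [r]: the term at the head index is a delta sequence, and the rest is supported on
    the tail. *)
Lemma zseries_cvg_finite_support u (r : seq int) : uniq r ->
  (forall k, k \notin r -> u k = 0) -> zseries_cvg_to u (\sum_(k <- r) u k).
Proof.
elim: r u => [|k0 r IH] u /=.
  move=> _ u0; rewrite big_nil.
  have -> : u = (fun k => if k == 0 then 0 else 0).
    by apply/funext => k; rewrite u0 //; case: ifP.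
  exact: zseries_cvg_delta.
move=> /andP[k0r ur] u0; rewrite big_cons.
pose v k := if k == k0 then 0 else u k.
have -> : u = (fun k => (if k == k0 then u k0 else 0) + v k).
  by apply/funext => k; rewrite /v; case: eqP => [->|_]; rewrite ?addr0 ?add0r.
rewrite /= eqxx /v eqxx addr0; apply: zseries_cvgD.
  exact: zseries_cvg_delta.
rewrite (eq_big_seq v) => [|k kr]; last first.
  by rewrite ifN ?add0r //; apply: contraNneq k0r => <-.
apply: IH => // k kr; rewrite /v; case: ifPn => // kk0.
by apply: u0; rewrite in_cons negb_or kk0.
Qed.

Lemma zseries_abs_cvg_finite_support u (r : seq int) :
  (forall k, k \notin r -> u k = 0) -> zseries_abs_cvg u.
Proof.
move=> u0; rewrite /zseries_abs_cvg /summable.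
have fr : finite_set [set` r] by exact: finite_seq.
rewrite (_ : \esum_(_ in _) _ =
    \esum_(k in [set` r]) `|(ComplexField.Normc.normc (u k))%:E|)%E; last first.
  rewrite [RHS]esum_mkcond; apply: eq_esum => k _; case: ifPn => // kr.
  rewrite u0 ?ComplexField.Normc.normc0 ?abse0 //.
  by apply: contra kr; rewrite inE.
rewrite esum_fset // fsbig_finite //= ltey_eq; apply/orP; left.
by apply/sum_fin_numP => k _ _.
Qed.

Lemma zseries_cvg_unique u s t :
  zseries_cvg_to u s -> zseries_cvg_to u t -> s = t.
Proof.
move=> [s1 [s2 [us1 us2 ->]]] [t1 [t2 [ut1 ut2 ->]]].
have -> : s1 = t1 :> R[i]^o by apply: cvg_unique us1 ut1.
by have -> : s2 = t2 :> R[i]^o by apply: cvg_unique us2 ut2.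
Qed.

(** The terms of a convergent series tend to 0, so a 0-1 sequence of terms vanishes eventually and s
    counts the ones. *)
Lemma series_bool_cvg w s : (forall k, w k = 0 \/ w k = 1) ->
  series (w : nat -> R[i]^o) @ \oo --> (s : R[i]^o) ->
  exists2 n : nat, s = n%:R & n = 0%N -> forall k, w k = 0.
Proof.
move=> w01 ws.
have w0 : (w : nat -> R[i]^o) @ \oo --> (0 : R[i]^o).
  by apply: cvg_series_cvg_0; apply/cvg_ex; exists (s : R[i]^o).
have [N _ wN] : \forall k \near \oo, w k = 0.
  have /cvgrPdist_lt/(_ 1 ltr01) := w0; apply: filterS => k.
  by rewrite sub0r normrN; case: (w01 k) => -> //; rewrite normr1 ltxx.
have -> : s = \sum_(0 <= k < N) w k :> R[i]^o.
  exact: cvg_unique ws (series_finite_support wN).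
have e k : w k = (w k != 0)%:R.
  by case: (w01 k) => ->; rewrite ?eqxx ?oner_eq0.
rewrite (eq_bigr (fun k => (w k != 0)%:R)) => [|k _]; last exact: e.
rewrite -natr_sum; eexists => // s0 k.
have [kN|] := ltnP k N; last exact: wN.
move/eqP: s0; rewrite sum_nat_seq_eq0 => /allP /(_ k).
by rewrite mem_index_iota kN /= => /(_ isT); rewrite eqb0 negbK => /eqP.
Qed.

Lemma zseries_bool_cvg0 u : (forall k, u k = 0 \/ u k = 1) ->
  zseries_cvg_to u 0 -> forall k, u k = 0.
Proof.
move=> u01 [s1 [s2 [us1 us2]]].
have [n1 -> n1u] := series_bool_cvg (fun n => u01 (Posz n)) us1.
have [n2 -> n2u] := series_bool_cvg (fun n => u01 (Negz n)) us2.
rewrite -natrD => /esym/eqP; rewrite pnatr_eq0 addn_eq0 => /andP[/eqP n10 /eqP n20].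
by case=> k; [exact: n1u|exact: n2u].
Qed.

End ZSeries.

(** * Lower bound *)

Section Negligible.
Context {R : realType}.
Implicit Types (A N S : set R) (a t : R) (P : R -> Prop).

Local Notation null := (@completed_lebesgue_measure R).-negligible.
Local Notation leb := (measurable : set (set (@lebesgueTypeR R))).

Lemma mes_le A B : A `<=` B -> (mes A <= mes B)%E.
Proof. exact: (le_outer_measure (wlength idfun)^*%mu). Qed.

Lemma mes_bigcup_le (F : nat -> set R) :
  (mes (\bigcup_n F n) <= \sum_(n <oo) mes (F n))%E.
Proof. exact: (outer_measure_sigma_subadditive (wlength idfun)^*%mu). Qed.

Lemma mesU_le A B : (mes (A `|` B) <= mes A + mes B)%E.
Proof. exact: (outer_measureU2 (wlength idfun)^*%mu). Qed.

Lemma mes_ge0 A : (0 <= mes A)%E.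
Proof. exact: (outer_measure_ge0 (wlength idfun)^*%mu). Qed.

Lemma negligible_mes N : null N -> mes N = 0%E.
Proof.
move=> [N' [_ N'0 NN']]; apply/eqP; rewrite eq_le mes_ge0 andbT -N'0.
exact: mes_le.
Qed.

Lemma negligible_translate N t : null N -> null (translate t N).
Proof.
move=> [N' [mN' N'0 NN']]; exists (translate t N'); split.
- exact: measurable_translate.
- by rewrite -N'0; exact: mes_translate.
- by move=> x; exact: NN'.
Qed.

(** The exceptional set is a countable union of translates of one null set. *)
Lemma ae_orbit a P : ae P -> ae (fun x => forall k : int, P (x + k%:~R * a)).
Proof.
move=> aeP; have : null (\bigcup_n translate ((int_of_nat n)%:~R * a) (~` P)).
  by apply: negligible_bigcup => n; exact: negligible_translate.
apply: negligibleS => x /= /existsNP[k nP].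
by exists (nat_of_int k) => //=; rewrite /translate /= nat_of_intK.
Qed.

Lemma ae_int (P : int -> R -> Prop) :
  (forall k, ae (P k)) -> ae (fun x => forall k, P k x).
Proof.
move=> aeP; have : null (\bigcup_n ~` P (int_of_nat n)).
  by apply: negligible_bigcup => n; exact: aeP.
apply: negligibleS => x /= /existsNP[k nP].
by exists (nat_of_int k) => //=; rewrite nat_of_intK.
Qed.

Lemma ae_mono P Q : ae P -> (forall x, P x -> Q x) -> ae Q.
Proof. by move=> aeP PQ; apply: negligibleS aeP => x nQ /PQ. Qed.

Lemma ae_mono2 P Q (T : R -> Prop) :
  ae P -> ae Q -> (forall x, P x -> Q x -> T x) -> ae T.
Proof.
move=> aeP aeQ PQT; have := negligibleU aeP aeQ; apply: negligibleS => x nT.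
apply: contrapT => /not_orP[/contrapT Px /contrapT Qx]; exact: nT (PQT x Px Qx).
Qed.

End Negligible.

(** * Covering and packing by the translates of a set *)

Section Packing.
Context {R : realType}.
Variables (a : R) (a0 : 0 < a) (S : set R).
Hypothesis mS : measurable (S : set (@lebesgueTypeR R)).
Hypothesis covS : ae (fun x => exists k : int, S (x + k%:~R * a)).

Local Notation A n := (translate ((int_of_nat n)%:~R * a) S `&` `[0, a[).

Let mA n : measurable (A n : set (@lebesgueTypeR R)).
Proof.
apply: measurableI; first exact: measurable_translate.
by apply: lebesgue_measurable_borel; exact: measurable_itv.
Qed.

(** Almost every point of [0, a) lies in some A n, so countable subadditivity gives the bound. The
    general F allows a second use in [overlap0], with one A i made smaller. *)
Let cover_ge (F : nat -> set R) : \bigcup_n A n `<=` \bigcup_n F n ->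
  (a%:E <= \sum_(n <oo) mes (F n))%E.
Proof.
move=> AF; apply: le_trans (mes_bigcup_le F); apply: le_trans (mes_le AF).
rewrite -mes_itv0 // -[leRHS]adde0 -(negligible_mes covS).
apply: le_trans (mesU_le _ _); apply: mes_le => x xa.
have [[k Sk]|nk] := pselect (exists k : int, S (x + k%:~R * a)); last by right.
by left; exists (nat_of_int k) => //; split => //; rewrite /translate /= nat_of_intK.
Qed.

Lemma covering_mes_ge : (a%:E <= mes S)%E.
Proof. by rewrite (mes_fold a0 mS); exact: cover_ge. Qed.

Hypothesis Sa : (mes S <= a%:E)%E.

(* Removing A j from A i does not change the union of the A n, and the total
   measure mes S has no room to decrease. *)
Let overlap0 i j : i != j -> mes (A i `&` A j) = 0%E.
Proof.
move=> ij; pose B n := if n == i then A i `\` A j else A n.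
have Bge : (a%:E <= \sum_(n <oo) mes (B n))%E.
  apply: cover_ge => x [n _ An]; have [nj|nj] := pselect (A j x).
    by exists j => //; rewrite /B eq_sym (negbTE ij).
  by exists n => //; rewrite /B; case: eqP => // <-.
pose d n := if n == i then mes (A i `&` A j) else 0%E.
have AB n : (mes (A n) = mes (B n) + d n)%E.
  rewrite /B /d; case: eqP => [->|_]; last by rewrite adde0.
  by rewrite addeC; exact: (mA j (A i)).
have d0 n : (0 <= d n)%E by rewrite /d; case: ifP => // _; exact: mes_ge0.
have : (a%:E + mes (A i `&` A j) <= a%:E)%E.
  apply: le_trans Sa; rewrite (mes_fold a0 mS).
  rewrite (eq_eseriesr (fun n _ => AB n)) nneseriesD //.
  apply: leeD => //; apply: le_trans (nneseries_lim_ge i.+1 (fun n _ _ => d0 n)).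
  rewrite big_nat_recr //= /d eqxx; apply: leeDr.
  by apply: sume_ge0 => n _; exact: d0.
rewrite -[leRHS]adde0 leeD2lE // => le0.
by apply/eqP; rewrite eq_le le0 mes_ge0.
Qed.

Lemma packing_ae : ae (fun x => S x -> forall k : int, k != 0 -> ~ S (x + k%:~R * a)).
Proof.
have null0 i j : i != j -> ae (fun x => ~ (A i `&` A j) x).
  move=> ij; exists (A i `&` A j); split; first exact: measurableI.
    exact: overlap0.
  by move=> x /= /contrapT.
pose P x := forall k m : int, k != m -> ~ (A (nat_of_int k) `&` A (nat_of_int m)) x.
have aeP : ae P.
  apply: ae_int => k; apply: ae_int => m.
  have [->|km] := eqVneq k m; first exact: aeW.
  have /null0 h : nat_of_int k != nat_of_int m.
    by rewrite (inj_eq (can_inj nat_of_intK)).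
  by apply: (ae_mono h) => x.
apply: (ae_mono (ae_orbit a aeP)) => x + Sx k k0 Sk.
(* Both x and x + k a fold to the residue of x, which would therefore lie in the pieces of index z
   and z + k at once. *)
set z := quo a x; move=> /(_ (- z) z (z + k)).
have xz : x + (- z)%:~R * a = residue a x by rewrite rmorphN mulNr.
rewrite xz -[X in X != _]addr0 (inj_eq (addrI _)) eq_sym => /(_ k0); apply.
have rx : `[0, a[%classic (residue a x).
  by rewrite /= in_itv /= residue_ge0 // residue_lt.
split; split => //; rewrite /translate /= nat_of_intK.
  by rewrite -quo_residue.
by rewrite rmorphD mulrDl addrA -quo_residue.
Qed.

End Packing.

Section LowerBound.
Context {R : realType}.
Variables (alpha beta : R).

Lemma measurable_supp (f : R -> R[i]) : lebesgue_measurable f ->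
  measurable (supp f : set (@lebesgueTypeR R)).
Proof.
move=> mf; have /(mf measurableT) : measurable ([set z | z != 0] : set (@borelTypeC R)).
  apply: sub_sigma_algebra; rewrite (_ : [set z | _] = ~` [set 0 : R[i]^o]); last first.
    by apply/seteqP; split => z /= /eqP.
  apply: closed_openC; apply: accessible_closed_set1.
  by apply: hausdorff_accessible; exact: norm_hausdorff.
by rewrite setTI.
Qed.

Lemma mes_supp_gt (f : R -> R[i]) : 0 < alpha ->
  lebesgue_measurable f -> tiles_at_level f alpha 1 ->
  tiles_at_level f beta 0 -> (alpha%:E < mes (supp f))%E.
Proof.
move=> alpha0 mf [_ fa] [_ fb]; rewrite ltNge; apply/negP => Sle.
have mS := measurable_supp mf.
(* On an orbit that misses the support the sum would be 0 instead of 1. *)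
have cov : ae (fun x => exists k : int, supp f (x + k%:~R * alpha)).
  apply: (ae_mono fa) => x cx; apply: contrapT => /forallNP nS.
  have f0 k : k \notin [::] -> f (x - k%:~R * alpha) = 0.
    move=> _; apply/eqP/negPn/negP => fk; apply: (nS (- k)).
    by rewrite /supp /= rmorphN mulNr.
  have /eqP := zseries_cvg_unique cx (@zseries_cvg_finite_support _
    (fun k => f (x - k%:~R * alpha)) [::] isT f0).
  by rewrite big_nil oner_eq0.
have f1 : ae (fun x => f x = 0 \/ f x = 1).
  apply: (ae_mono2 fa (packing_ae alpha0 mS cov Sle)) => x cx px.
  have [fx0|/eqP fx0] := pselect (f x = 0); [by left|right].
  have f0 k : k \notin [:: 0 : int] -> f (x - k%:~R * alpha) = 0.
    rewrite inE => k0; apply/eqP/negPn/negP => fk.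
    by apply: (px fx0 (- k)); rewrite ?oppr_eq0 // /supp /= rmorphN mulNr.
  rewrite (zseries_cvg_unique cx (@zseries_cvg_finite_support _
    (fun k => f (x - k%:~R * alpha)) [:: 0] isT f0)).
  by rewrite big_seq1 mul0r subr0.
have f0 : ae (fun x => f x = 0).
  apply: (ae_mono2 fb (ae_orbit beta f1)) => x cx fx.
  have := @zseries_bool_cvg0 _ (fun k => f (x - k%:~R * beta)) _ cx 0.
  rewrite mul0r subr0; apply => k.
  by have := fx (- k); rewrite rmorphN mulNr.
have S0 : mes (supp f) = 0%E.
  apply: negligible_mes; apply: negligibleS f0 => x /= /eqP; exact.
(* A null support contradicts the covering, which forces measure at least [alpha]. *)
have := covering_mes_ge alpha0 mS cov.
by rewrite S0 lee_fin leNgt alpha0.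
Qed.

End LowerBound.

(** * Orbits of the rotation by beta modulo alpha *)

Section Records.
Context {R : realType}.
Variables (w : nat -> R) (c : R) (n : nat) (rho : nat -> nat).

(* Ties are allowed only at the level c. *)
Definition truncated_record k :=
  all (fun i => Order.min (w k) c <= w i) (index_iota 1 k).

Lemma truncated_recordP k : reflect
  (forall i, (0 < i < k)%N -> Order.min (w k) c <= w i) (truncated_record k).
Proof.
apply: (iffP allP) => h i; first by move=> ik; apply: h; rewrite mem_index_iota.
by rewrite mem_index_iota; exact: h.
Qed.

Hypothesis n0 : (0 < n)%N.
Hypothesis wn : w n < w 0%N.
Hypothesis wj : forall j, (0 < j < n)%N -> w 0%N < w j.
Hypothesis rho_eq1 : forall k, c <= w k -> rho k = 1%N.
Hypothesis rho_gt0 : forall k, (0 < k < n)%N -> (0 < rho k)%N.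
Hypothesis rho_lt : forall k, (0 < k < n)%N -> w k < c -> w (k + rho k)%N < w k.
Hypothesis rho_min : forall k, (0 < k < n)%N -> w k < c -> forall j,
  (0 < j < rho k)%N -> w k < w (k + j)%N.

(** In the application [w k] is the residue of b + k beta modulo alpha, n is the return time of b
    and [rho k] that of b + k beta. Since w n < w 0 < w k, the orbit has dropped below w k by time n
    at the latest. *)
Lemma rho_le k : (0 < k < n)%N -> (k + rho k <= n)%N.
Proof.
move=> kn; have [wkc|cwk] := ltP (w k) c; last by rewrite rho_eq1 //; lia.
rewrite leqNgt; apply/negP => nk.
have /(rho_min kn wkc) : (0 < n - k < rho k)%N by lia.
have -> : (k + (n - k) = n)%N by lia.
by move/lt_trans/(_ wn); rewrite ltNge (ltW (wj kn)).
Qed.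

(** If w k >= c, all earlier values are at least c and the next index is a record by truncation. If
    w k < c, the value at k + rho k is below w k, while everything before it is at least w k. *)
Lemma truncated_record_next k : (0 < k < n)%N -> truncated_record k ->
  truncated_record (k + rho k).
Proof.
move=> kn /truncated_recordP rk; apply/truncated_recordP => i ik.
have [wkc|cwk] := ltP (w k) c; last first.
  rewrite ge_min; apply/orP; right; rewrite rho_eq1 // in ik.
  have [->//|ik'] := eqVneq i k.
  by apply: le_trans (rk i _); [rewrite le_min lexx cwk|lia].
rewrite ge_min; apply/orP; left; apply: ltW; apply: (lt_le_trans (rho_lt kn wkc)).
have [ilt|ige] := ltnP i k.
  by apply: le_trans (rk i _); [rewrite le_min lexx ltW|lia].
have [->//|ik'] := eqVneq i k.
have /(rho_min kn wkc) : (0 < i - k < rho k)%N by lia.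
by rewrite subnKC // => /ltW.
Qed.

(** A gap exists only if w k < c; inside it both w i and c exceed w k, so k itself prevents i from
    being a record. *)
Lemma truncated_record_gap k i : (0 < k < n)%N -> truncated_record k ->
  (k < i < k + rho k)%N -> ~~ truncated_record i.
Proof.
move=> kn rk ik; apply/negP => /truncated_recordP /(_ k).
have [wkc|cwk] := ltP (w k) c; last by rewrite rho_eq1 // in ik; lia.
have /(rho_min kn wkc) : (0 < i - k < rho k)%N by lia.
rewrite subnKC; last by lia.
move=> wki /(_ _); rewrite ge_min (leNgt c) wkc leNgt wki /=.
by move=> h; have : false by apply: h; lia.
Qed.

(** Strong induction on n - k, jumping from k to the next record k + rho k; the jumps add up to the
    distance to n. *)
Lemma sum_truncated_records_from k : (0 < k <= n)%N -> truncated_record k ->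
  (\sum_(k <= i < n | truncated_record i) rho i = n - k)%N.
Proof.
have [m] := ubnP (n - k); elim: m k => // m IH k nkm /andP[k0 kn] rk.
have [kn'|nk] := ltnP k n; last first.
  by rewrite big_geq //; lia.
have kn2 : (0 < k < n)%N by rewrite k0.
have r0 := rho_gt0 kn2; have rle := rho_le kn2.
rewrite big_ltn_cond // rk (@big_cat_nat _ _ _ (k + rho k)%N) //=; last by lia.
rewrite [X in (_ + (X + _))%N]big_nat_cond big_pred0 => [|i]; last first.
  apply/negP => /andP[ik]; apply/negP; apply: (truncated_record_gap kn2) => //.
rewrite IH //; [lia|lia|lia|exact: truncated_record_next].
Qed.

Lemma sum_truncated_records :
  (\sum_(1 <= i < n | truncated_record i) rho i = n.-1)%N.
Proof.
(* The index 1 is a record vacuously. *)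
by rewrite sum_truncated_records_from ?subn1 //; apply/truncated_recordP; lia.
Qed.

End Records.

(** * Density of the forward orbits of the rotation *)

Section Hitting.
Context {R : realType}.
Variables (a b : R).
Hypothesis a0 : 0 < a.
Hypothesis indep : forall j z : int, j != 0 -> j%:~R * b != z%:~R * a.

(* Pigeonhole on the residues of 0, b, ..., N b. *)
Lemma small_step h : 0 < h ->
  exists d : nat, exists z : int, [/\ (0 < d)%N, d%:R * b + z%:~R * a != 0
    & `|d%:R * b + z%:~R * a| < h].
Proof.
(* With this N, the interval [0, a) splits into N bins of width a / N < h. *)
move=> h0; pose N := (Num.trunc (a / h)).+1.
pose bin (j : nat) := Num.trunc (residue a (j%:R * b) / (a / N%:R)).
have Nh : a / N%:R < h.
  rewrite ltr_pdivrMr ?ltr0n // mulrC -ltr_pdivrMr //; exact: truncnS_gt.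
have bin_lt j : (bin j < N)%N.
  have u0 := residue_ge0 (j%:R * b) a0; have ua := residue_lt (j%:R * b) a0.
  have aN : 0 < a / N%:R by rewrite divr_gt0 // ltr0n.
  rewrite /bin truncn_lt_nat ?divr_ge0 // ?ltW // ltr_pdivrMr //.
  by rewrite mulrCA divff ?mulr1 // pnatr_eq0.
pose F (j : 'I_N.+1) : 'I_N := Ordinal (bin_lt j).
have : ~~ injectiveb F.
  by apply/negP => /injectiveP /leq_card; rewrite !card_ord ltnn.
case/injectivePn => i [j ij Fij].
wlog lt_ij : i j ij Fij / (i < j)%N.
  move=> H; have := ij; rewrite neq_ltn => /orP[lt|lt]; first exact: H Fij lt.
  by apply: (H j i) => //; rewrite eq_sym.
(* The integer z turns the step into the difference of the residues of j b and i b, which share a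
   bin. *)
exists (j - i)%N, (quo a (i%:R * b) - quo a (j%:R * b)).
have e : (j - i)%:R * b + (quo a (i%:R * b) - quo a (j%:R * b))%:~R * a =
    residue a (j%:R * b) - residue a (i%:R * b).
  by rewrite /residue natrB ?(ltnW lt_ij) // rmorphB /=; lra.
split; first by rewrite subn_gt0.
  rewrite addr_eq0 -mulNr -rmorphN /= -[(j - i)%:R]/((Posz (j - i))%:~R).
  by apply: indep; apply/eqP => -[] /eqP; rewrite subn_eq0 leqNgt lt_ij.
rewrite e.
have aN : 0 < a / N%:R by rewrite divr_gt0 // ltr0n.
apply: (lt_trans _ Nh).
have tr k : (bin k)%:R * (a / N%:R) <= residue a (k%:R * b)
    < (bin k).+1%:R * (a / N%:R).
  have q0 : 0 <= residue a (k%:R * b) / (a / N%:R).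
    by rewrite divr_ge0 ?residue_ge0 // ltW.
  by rewrite -ler_pdivlMr // -ltr_pdivrMr // truncn_le q0 truncnS_gt.
have Tij : bin i = bin j by have := congr1 val Fij.
move: (tr i) (tr j); rewrite Tij; move: (bin j) => T.
rewrite -natr1 mulrDl mul1r ltr_norml => /andP[t1 t2] /andP[t3 t4].
by apply/andP; split; lra.
Qed.

(* Multiples of a nonzero step of length < h, whatever its sign, cannot jump
   over [0, h) modulo a. *)
Lemma orbit_hits x h : 0 < h ->
  exists j : nat, (0 < j)%N /\ residue a (x + j%:R * b) < h.
Proof.
(* The step is also made shorter than a, so that a point of [0, |e|) is its own residue modulo a. *)
move=> h0; have m0 : 0 < Order.min h a by rewrite lt_min h0.
have [d [z [d0 e0]]] := small_step m0; set e := (d%:R * b + _) in e0 *.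
rewrite lt_min => /andP[eh ea].
have hit (m : nat) (q : int) : (0 < m)%N -> 0 <= x + m%:R * e - q%:~R * a < `|e| ->
    exists j : nat, (0 < j)%N /\ residue a (x + j%:R * b) < h.
  move=> m_gt0 me; exists (m * d)%N; split; first by rewrite muln_gt0 m_gt0.
  have -> : x + (m * d)%:R * b = (x + m%:R * e - q%:~R * a) + (q - m%:Z * z)%:~R * a.
    by rewrite /e natrM rmorphB rmorphM /=; lra.
  rewrite residueD // residue_id //.
    by case/andP: me => _ /lt_trans; apply.
  by case/andP: me => -> /lt_trans -> .
have [e_gt0|e_lt0|e_eq0] := ltgtP 0 e; last by rewrite -e_eq0 eqxx in e0.
(* Steps go up: starting from the translate of x in [-a, 0), at least one is needed to reach [0,
   e). *)
- pose y := x - (quo a x + 1)%:~R * a.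
  have y0 : y < 0.
    rewrite subr_lt0 -ltr_pdivrMr //; exact: floorD1_gt.
  have q0 : quo e y < 0 by rewrite floor_lt0 ltr_pdivrMr // mul0r.
  case E : (quo e y) q0 => [//|m] _.
  apply: (hit m.+1 (quo a x + 1)) => //.
  have -> : x + m.+1%:R * e - (quo a x + 1)%:~R * a = residue e y.
    by rewrite /residue E NegzE rmorphN /= /y; lra.
  by rewrite residue_ge0 // gtr0_norm // residue_lt.
(* Steps go down: starting from the translate of x in [a, 2a), at least one is needed because |e| <
   a. *)
- pose y := x - (quo a x - 1)%:~R * a; pose e' := - e.
  have e'0 : 0 < e' by rewrite oppr_gt0.
  have ye : e' <= y.
    apply: (le_trans (y := a)); first by rewrite /e' -(ltr0_norm e_lt0) ltW.
    have := residue_ge0 x a0; rewrite /residue /y rmorphB /=; lra.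
  have q0 : 0 < quo e' y by rewrite floor_gt0 ler_pdivlMr // mul1r.
  case E : (quo e' y) q0 => [m|//] m_gt0.
  apply: (hit m (quo a x - 1)) => //.
  have -> : x + m%:R * e - (quo a x - 1)%:~R * a = residue e' y.
    by rewrite /residue E /= /y /e'; lra.
  by rewrite residue_ge0 // ltr0_norm // residue_lt.
Qed.

End Hitting.

(** * Construction *)

Section FirstPositive.
Implicit Types (P : nat -> bool) (j : nat).

(* The value is 0 when P holds at no positive integer. *)
Definition first_pos P : nat :=
  match pselect (exists j, (0 < j)%N && P j) with
  | left h => ex_minn h
  | right _ => 0%N
  end.

Lemma first_pos_eq0 P : (forall j, (0 < j)%N -> ~~ P j) -> first_pos P = 0%N.
Proof.
move=> nP; rewrite /first_pos; case: pselect => // h; exfalso.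
by case: h => j /andP[j0 Pj]; have := nP j j0; rewrite Pj.
Qed.

Lemma first_posP P j : (0 < j)%N -> P j ->
  [/\ (0 < first_pos P)%N, P (first_pos P) &
      forall i, (0 < i < first_pos P)%N -> ~~ P i].
Proof.
move=> j0 Pj; rewrite /first_pos; case: pselect => [h|[]]; last first.
  by exists j; rewrite j0.
case: ex_minnP => m /andP[m0 Pm] mmin; split => // i /andP[i0 im].
by apply/negP => Pi; have := mmin i; rewrite i0 Pi leqNgt im => /(_ isT).
Qed.

Lemma first_pos_eq P j : (0 < j)%N -> P j ->
  (forall i, (0 < i < j)%N -> ~~ P i) -> first_pos P = j.
Proof.
move=> j0 Pj nP; have [m0 Pm mmin] := first_posP j0 Pj.
have [lt|gt|//] := ltngtP (first_pos P) j.
  by have := nP (first_pos P); rewrite m0 lt Pm => /(_ isT).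
by have := mmin j; rewrite j0 gt Pj => /(_ isT).
Qed.

(** For n > 0 the level set says that P holds at n and at no earlier positive index; the default
    level 0 is the complement of all the others. *)
Lemma measurable_first_pos d (T : measurableType d) (P : T -> nat -> bool) n :
  (forall j, measurable [set x | P x j]) ->
  measurable [set x | first_pos (P x) = n].
Proof.
move=> mP; pose Q (m : nat) := [set x | forall j, (0 < j < m)%N -> ~~ P x j].
have mQ m : measurable (Q m).
  rewrite (_ : Q m = \bigcap_j (if (0 < j < m)%N then ~` [set x | P x j] else setT)).
    by apply: bigcapT_measurable => j; case: ifP => // _; exact: measurableC.
  apply/seteqP; split => [x Qx j _|x Qx j jm].
    by case: ifPn => // jm /=; apply/negP; exact: Qx.
  by have := Qx j Logic.I; rewrite jm => /negP.
have mpos m : (0 < m)%N -> measurable [set x | first_pos (P x) = m].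
  move=> m0; rewrite (_ : [set x | _] = [set x | P x m] `&` Q m).
    exact: measurableI.
  apply/seteqP; split => x /=; last by case=> Pm Qm; exact: first_pos_eq.
  move=> xm; have [[j [j0 Pj]]|nex] := pselect (exists j, (0 < j)%N /\ P x j).
    by have [_] := first_posP j0 Pj; rewrite xm.
  rewrite first_pos_eq0 in xm; first by rewrite -xm in m0.
  by move=> j j0; apply/negP => Pj; apply: nex; exists j.
case: n => [|n]; last exact: mpos.
rewrite (_ : [set x | _] = ~` \bigcup_m [set x | first_pos (P x) = m.+1]).
  by apply: measurableC; apply: bigcupT_measurable => m; exact: mpos.
apply/seteqP; split => [x /= x0 [m _] /=|x /= nx]; first by rewrite x0.
by case E : (first_pos (P x)) => [//|m]; case: nx; exists m.
Qed.

End FirstPositive.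

Section Construction.
Context {R : realType}.
Variables (alpha beta c : R).
Hypotheses (alpha0 : 0 < alpha) (beta0 : 0 < beta).
Hypothesis indep : forall j z : int, j != 0 -> j%:~R * beta != z%:~R * alpha.
Hypotheses (c0 : 0 < c) (c_alpha : c <= alpha) (c_beta : c <= beta).

Local Notation u := (residue alpha).

(** The function rho of the overview. The default 0 of [first_pos] can occur only where u x = 0,
    which [generic] excludes. *)
Definition return_time (x : R) : nat :=
  if u x < c then first_pos (fun j => u (x + j%:R * beta) < u x) else 1%N.

Definition back_time (x : R) : nat :=
  first_pos (fun j => u (x - j%:R * beta) < Order.min (u x) c).

(** The set E of the overview: x = b + k beta with k = [back_time x]. *)
Definition in_tower (x : R) : bool := 0 <= x - (back_time x)%:R * beta < c.

Definition tiling_fun (x : R) : R[i] :=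
  (if in_tower x then (return_time x)%:R else 0) -
  (if 0 <= x < c then (return_time x).-1%:R else 0).

Lemma return_timeD x (z : int) : return_time (x + z%:~R * alpha) = return_time x.
Proof.
rewrite /return_time residueD //; case: ifP => // _; congr first_pos.
by apply/funext => j; rewrite addrAC residueD.
Qed.

Lemma back_timeD x (z : int) : back_time (x + z%:~R * alpha) = back_time x.
Proof.
rewrite /back_time residueD //; congr first_pos.
by apply/funext => j; rewrite addrAC residueD.
Qed.

(** As c <= alpha, the only translate of x by alpha Z that can lie in [0, c) is its residue. *)
Lemma in_base x (z : int) :
  (0 <= x - z%:~R * alpha < c) = (z == quo alpha x) && (u x < c).
Proof.
apply/idP/andP => [/andP[h1 h2]|[/eqP->]].
  have : quo alpha (x - z%:~R * alpha) = 0.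
    by apply: quo_eq0; rewrite // h1 (lt_le_trans h2).
  rewrite -mulNr -rmorphN quoD // => /eqP; rewrite subr_eq0 => /eqP qz.
  by rewrite qz eqxx /residue qz.
by rewrite -/(u x) residue_ge0.
Qed.

Let indepN (j z : int) : j != 0 -> j%:~R * - beta != z%:~R * alpha.
Proof. by move=> j0; rewrite mulrN -mulNr -rmorphN indep // oppr_eq0. Qed.

(** If the search finds some j, the bound is part of its predicate. If it fails, [back_time] is 0
    and u x < c, since for u x >= c the backward orbit would hit [0, c). *)
Lemma back_lt x : u (x - (back_time x)%:R * beta) < c.
Proof.
have [[j [j0 uj]]|nex] := pselect (exists j : nat, (0 < j)%N /\
    u (x - j%:R * beta) < Order.min (u x) c).
  have [_ + _] := first_posP
    (P := fun j => u (x - j%:R * beta) < Order.min (u x) c) j0 uj.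
  by rewrite lt_min => /andP[].
rewrite /back_time first_pos_eq0 => [|j j0]; last first.
  by apply/negP => uj; apply: nex; exists j.
rewrite mul0r subr0 ltNge; apply/negP => cu; apply: nex.
have [j [j0 uj]] := orbit_hits alpha0 indepN x c0.
by exists j; rewrite lt_min -mulrN uj (lt_le_trans uj cu).
Qed.

(** This makes E a fundamental domain for alpha Z: exactly one z qualifies, because [back_time] is
    alpha-periodic and [back_lt] puts the base point in [0, c) modulo alpha. *)
Lemma in_tower_shift x (z : int) :
  in_tower (x - z%:~R * alpha) = (z == quo alpha (x - (back_time x)%:R * beta)).
Proof.
rewrite /in_tower -mulNr -rmorphN back_timeD rmorphN mulNr addrAC in_base.
by rewrite back_lt andbT.
Qed.

(** Discards the countable group alpha Z + beta Z, on whose orbits a residue can be 0 and a first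
    time undefined. *)
Definition generic (x : R) := forall k m : int, x != k%:~R * alpha + m%:~R * beta.

Lemma genericD x (k m : int) : generic x ->
  generic (x + (k%:~R * alpha + m%:~R * beta)).
Proof.
move=> gx k' m'; have := gx (k' - k) (m' - m).
apply: contraNneq => e; rewrite !rmorphB /= !mulrBl; apply/eqP; lra.
Qed.

Lemma generic_residue_gt0 x : generic x -> 0 < u x.
Proof.
move=> gx; rewrite lt_neqAle residue_ge0 // andbT eq_sym subr_eq0.
by have := gx (quo alpha x) 0; rewrite mul0r addr0.
Qed.

Lemma ae_generic : ae generic.
Proof.
pose A := [set x : R | exists km : int * int, km.1%:~R * alpha + km.2%:~R * beta = x].
have : countable A.
  rewrite (_ : A = range (fun km : int * int => km.1%:~R * alpha + km.2%:~R * beta)).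
    exact: (sub_countable (card_image_le _ _)).
  by apply/seteqP; split => x; [case=> km <-; exists km|case=> km _ <-; exists km].
move/negligible_countable; apply: negligibleS => x /= /existsNP[k /existsNP[m]].
by move/negP/negPn/eqP => ->; exists (k, m).
Qed.

Lemma generic_residue_neq x (i j : nat) : i != j ->
  u (x + i%:R * beta) != u (x + j%:R * beta).
Proof.
move=> ij; apply/eqP; rewrite /residue => e.
have /eqP[] : (Posz i - Posz j)%:~R * beta !=
    (quo alpha (x + i%:R * beta) - quo alpha (x + j%:R * beta))%:~R * alpha.
  by apply: indep; rewrite subr_eq0; apply: contra ij => /eqP[->].
by rewrite !rmorphB /=; move: e; rewrite !mulrBl; lra.
Qed.

Lemma return_time_spec x : generic x -> u x < c ->
  [/\ (0 < return_time x)%N, u (x + (return_time x)%:R * beta) < u x &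
   forall j, (0 < j < return_time x)%N -> u x < u (x + j%:R * beta)].
Proof.
move=> gx xc; rewrite /return_time xc.
have [j [j0 uj]] := orbit_hits alpha0 indep x (generic_residue_gt0 gx).
have [? ? h] := first_posP (P := fun j => u (x + j%:R * beta) < u x) j0 uj.
split => // i i_lt; rewrite lt_neqAle leNgt h // andbT.
have := @generic_residue_neq x 0%N i; rewrite mul0r addr0; apply.
by rewrite eq_sym -lt0n; case/andP: i_lt.
Qed.

Lemma return_time_gt0 x : generic x -> (0 < return_time x)%N.
Proof.
move=> gx; have [xc|cx] := ltP (u x) c; first by have [] := return_time_spec gx xc.
by rewrite /return_time ltNge cx.
Qed.

Lemma back_time_gt0 x : generic x -> (0 < back_time x)%N.
Proof.
move=> gx; have m0 : 0 < Order.min (u x) c by rewrite lt_min generic_residue_gt0.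
have [j [j0]] := orbit_hits alpha0 indepN x m0; rewrite mulrN => uj.
by have [] := first_posP (P := fun j => u (x - j%:R * beta) < Order.min (u x) c) j0 uj.
Qed.

(** One translate lies in E and contributes rho x. If u x < c, one lies in [0, c) and contributes
    -(rho x - 1); otherwise none does and rho x = 1. *)
Lemma tiling_fun_alpha x : generic x ->
  zseries_abs_cvg (fun k => tiling_fun (x - k%:~R * alpha)) /\
  zseries_cvg_to (fun k => tiling_fun (x - k%:~R * alpha)) 1.
Proof.
move=> gx; pose k1 := quo alpha (x - (back_time x)%:R * beta).
pose k2 := quo alpha x; pose s : R[i] := if u x < c then (return_time x).-1%:R else 0.
have fE k : tiling_fun (x - k%:~R * alpha) =
    (if k == k1 then (return_time x)%:R else 0) + (if k == k2 then - s else 0).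
  rewrite /tiling_fun in_tower_shift in_base -mulNr -rmorphN return_timeD -/k1 -/k2 /s.
  by congr (_ + _); case: eqP => _ /=; rewrite ?oppr0 //; case: ifP; rewrite ?oppr0.
split.
  apply: (@zseries_abs_cvg_finite_support _ _ [:: k1; k2]) => k.
  by rewrite !inE negb_or fE => /andP[/negbTE-> /negbTE->]; rewrite addr0.
rewrite (_ : 1 = (return_time x)%:R + - s); last first.
  rewrite /s /return_time; case: ifP => ux; last by rewrite subr0.
  have := return_time_gt0 gx; rewrite /return_time ux; case: first_pos => // n _.
  by rewrite -natr1 addrAC subrr add0r.
rewrite (funext fE); apply: zseries_cvgD; exact: zseries_cvg_delta.
Qed.

Section BetaOrbit.
Variable b : R.
Hypotheses (gb : generic b) (b_beta : 0 <= b < beta).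

Let w (i : nat) := u (b + i%:R * beta).

(** As c <= beta, the orbit of b under beta Z can meet [0, c) only at b, so a point of E on it has
    its index l as back time. *)
Let in_beta (l : int) (n : nat) :
  0 <= b + l%:~R * beta - n%:R * beta < c -> l = n /\ b < c.
Proof.
rewrite (_ : b + l%:~R * beta - n%:R * beta = b + (l - Posz n)%:~R * beta); last first.
  by rewrite rmorphB mulrBl addrA.
move=> /andP[h1 h2].
have : quo beta (b + (l - Posz n)%:~R * beta) = 0.
  by apply: quo_eq0; rewrite // h1 (lt_le_trans h2).
rewrite quoD // quo_eq0 // add0r => /eqP; rewrite subr_eq0 => /eqP ln; split => //.
by move: h2; rewrite ln subrr mul0r addr0.
Qed.

Lemma tiling_fun_beta_large (l : int) : c <= b -> tiling_fun (b + l%:~R * beta) = 0.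
Proof.
move=> cb; rewrite /tiling_fun !ifF ?subr0 //.
  apply/negP => h; have [|_] := @in_beta l 0%N; first by rewrite mul0r subr0.
  by rewrite ltNge cb.
by apply/negP => /in_beta[_]; rewrite ltNge cb.
Qed.

Hypothesis b_c : b < c.

Let n := return_time b.

Let w0 : w 0%N = b.
Proof.
rewrite /w mul0r addr0 residue_id //.
by case/andP: b_beta => -> _; rewrite (lt_le_trans b_c).
Qed.

Let gk (k : nat) : generic (b + k%:R * beta).
Proof. by have := @genericD b 0 k gb; rewrite mul0r add0r. Qed.

Let ret_spec : [/\ (0 < n)%N, w n < b & forall j, (0 < j < n)%N -> b < w j].
Proof.
have ub : u b = b by rewrite -w0 /w mul0r addr0 -[in RHS]w0 /w mul0r addr0.
by have := @return_time_spec b gb; rewrite ub => /(_ b_c).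
Qed.

(** Looking back j steps from index k means reading w at k - j. Success at j = k is the condition on
    b = w 0, and failure at all earlier j is the record condition. *)
Lemma back_time_record (k : nat) : (0 < k)%N ->
  (back_time (b + k%:R * beta) == k) =
  (b < Order.min (w k) c) && truncated_record w c k.
Proof.
move=> k0; pose P j := u (b + k%:R * beta - j%:R * beta) < Order.min (w k) c.
have PE j : (j <= k)%N -> P j = (w (k - j)%N < Order.min (w k) c).
  by move=> jk; rewrite /P /w natrB // mulrBl addrA.
have nPE : (forall i, (0 < i < k)%N -> ~~ P i) <-> truncated_record w c k.
  split => [h|/truncated_recordP h].
    apply/truncated_recordP => i ik; rewrite leNgt.
    have := h (k - i)%N; rewrite PE ?leq_subr // subKn; last by lia.
    by apply; lia.
  by move=> i ik; rewrite PE -?leNgt; [apply: h|]; lia.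
rewrite /back_time -/(w k) -/P; apply/eqP/andP => [fk|[bk rk]].
  have [[j [j0 Pj]]|nex] := pselect (exists j, (0 < j)%N /\ P j); last first.
    rewrite first_pos_eq0 in fk; first by rewrite -fk in k0.
    by move=> j j0; apply/negP => Pj; apply: nex; exists j.
  have [_] := first_posP j0 Pj; rewrite fk => Pk nP; split; last exact/nPE.
  by move: Pk; rewrite PE // subnn w0.
by apply: first_pos_eq; [|rewrite PE // subnn w0|exact/nPE].
Qed.

Lemma tiling_fun_beta0 : tiling_fun b = - n.-1%:R.
Proof.
have [n0 _ _] := ret_spec.
rewrite /tiling_fun ifF; last first.
  apply/negP => h; have [|bk _] := @in_beta 0 (back_time b).
    by rewrite mul0r addr0.
  by have := back_time_gt0 gb; case: bk => <-.
by case/andP: b_beta => -> _; rewrite b_c sub0r.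
Qed.

Lemma tiling_fun_beta_pos (k : nat) : (0 < k)%N -> tiling_fun (b + k%:R * beta) =
  (if (k < n)%N && truncated_record w c k
   then return_time (b + k%:R * beta) else 0%N)%:R.
Proof.
move=> k0; rewrite /tiling_fun [X in _ - X]ifF ?subr0; last first.
  apply/negP => h; have [|[k00]] := @in_beta k 0%N; first by rewrite mul0r subr0.
  by rewrite k00 in k0.
have [n0 wnb wj] := ret_spec.
have -> : in_tower (b + k%:R * beta) = (back_time (b + k%:R * beta) == k).
  apply/idP/eqP => [/(@in_beta k)[[]]//|bk].
  by rewrite /in_tower bk addrK b_c; case/andP: b_beta => ->.
rewrite back_time_record //.
(* For k < n the condition b < min (w k) c is automatic. For k = n it fails since w n < b, and for k
   > n a record would give b < min (w k) c <= w n < b. *)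
have [kn|nk] := ltnP k n => /=.
  by rewrite lt_min b_c wj ?k0 //=; case: ifP.
rewrite ifF //; apply/negP => /andP[bk /truncated_recordP rk].
have [kn|kn] := eqVneq k n.
  by move: bk; rewrite kn lt_min ltNge (ltW wnb).
have := rk n; rewrite n0 ltn_neqAle eq_sym kn nk => /(_ isT).
by rewrite leNgt (lt_trans wnb bk).
Qed.

Lemma tiling_fun_beta_neg (k : nat) : tiling_fun (b + (Negz k)%:~R * beta) = 0.
Proof.
rewrite /tiling_fun !ifF ?subr0 //; last by apply/negP => /in_beta[].
by apply/negP => h; have [|] := @in_beta (Negz k) 0%N; first by rewrite mul0r subr0.
Qed.

Lemma tiling_fun_beta_sum : \sum_(0 <= k < n) tiling_fun (b + k%:R * beta) = 0.
Proof.
have [n0 wnb wj] := ret_spec.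
rewrite big_ltn // mul0r addr0 tiling_fun_beta0.
rewrite (eq_big_nat _ _ (F2 := fun k => (if truncated_record w c k
  then return_time (b + k%:R * beta) else 0%N)%:R)); last first.
  by move=> k /andP[k0 kn]; rewrite tiling_fun_beta_pos // kn.
rewrite -natr_sum -big_mkcond /= (@sum_truncated_records _ w c n) ?addNr //.
- by rewrite w0.
- by move=> j jn; rewrite w0; exact: wj.
- by move=> k ck; rewrite /return_time ltNge ck.
- by move=> k _; exact: return_time_gt0.
- move=> k _ wk; have [_ + _] := return_time_spec (gk k) wk.
  by rewrite /w natrD mulrDl addrA.
- move=> k _ wk j jk; have [_ _ /(_ _ jk)] := return_time_spec (gk k) wk.
  by rewrite /w natrD mulrDl addrA.
Qed.

End BetaOrbit.

Lemma tiling_fun_beta x : generic x ->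
  zseries_abs_cvg (fun k => tiling_fun (x - k%:~R * beta)) /\
  zseries_cvg_to (fun k => tiling_fun (x - k%:~R * beta)) 0.
Proof.
move=> gx; pose b := residue beta x; pose m := quo beta x.
have xb k : x - k%:~R * beta = b + (m - k)%:~R * beta.
  by rewrite {1}(quo_residue beta x) rmorphB mulrBl addrA.
have gb : generic b.
  have := @genericD x 0 (- m) gx; rewrite mul0r add0r rmorphN mulNr; exact.
have b_beta : 0 <= b < beta by rewrite residue_ge0 // residue_lt.
have [bc|cb] := ltP b c; last first.
  have f0 k : k \notin [::] -> tiling_fun (x - k%:~R * beta) = 0.
    by move=> _; rewrite xb tiling_fun_beta_large.
  split; first exact: zseries_abs_cvg_finite_support f0.
  have := @zseries_cvg_finite_support _
    (fun k => tiling_fun (x - k%:~R * beta)) [::] isT f0.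
  by rewrite big_nil.
(* The entries of r are the indices k for which x - k beta = b + j beta with 0 <= j < n. *)
pose n := return_time b; pose r := [seq m - Posz k | k <- index_iota 0 n].
have f0 k : k \notin r -> tiling_fun (x - k%:~R * beta) = 0.
  rewrite xb => kr; case E : (m - k) => [l|l]; last exact: tiling_fun_beta_neg.
  have nl : (n <= l)%N.
    rewrite leqNgt; apply: contra kr => ln; apply/mapP; exists l.
      by rewrite mem_index_iota.
    by rewrite -E opprB addrC subrK.
  have n0 := return_time_gt0 gb.
  by rewrite tiling_fun_beta_pos //; [rewrite ltnNge nl|exact: leq_trans nl].
split; first exact: zseries_abs_cvg_finite_support f0.
have ur : uniq r by rewrite map_inj_uniq ?iota_uniq // => i j /addrI/oppr_inj[].
have := zseries_cvg_finite_support ur f0; rewrite big_map.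
rewrite (eq_bigr (fun j : nat => tiling_fun (b + j%:R * beta))); last first.
  by move=> j _; rewrite xb; have -> : m - (m - Posz j) = j by lia.
by rewrite tiling_fun_beta_sum.
Qed.


(** * Measurability of the function and measure of its support *)

Local Notation borel := (measurable : set (set (measurableTypeR R))).

Lemma measurable_residue_shift (t : R) :
  measurable_fun setT ((fun x => u (x + t)) : measurableTypeR R -> measurableTypeR R).
Proof.
apply: (@measurableT_comp _ _ _ _ _ _
  (residue alpha : measurableTypeR R -> measurableTypeR R)).
  exact: measurable_residue.
by apply: measurable_funD; [exact: measurable_id|exact: measurable_cst].
Qed.

Lemma measurable_lt_set (f g : measurableTypeR R -> measurableTypeR R) :
  measurable_fun setT f -> measurable_fun setT g -> borel [set x | f x < g x].
Proof.
move=> mf mg; have := measurable_fun_ltr mf mg.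
move=> /(_ measurableT [set true] I); rewrite setTI.
by congr measurable; apply/seteqP; split.
Qed.

Lemma measurable_return_time n : borel [set x | return_time x = n].
Proof.
have mu : measurable_fun setT (u : measurableTypeR R -> measurableTypeR R).
  exact: measurable_residue.
have mc : borel [set x | u x < c].
  by apply: measurable_lt_set => //; exact: measurable_cst.
pose P x (j : nat) := u (x + j%:R * beta) < u x.
rewrite (_ : [set x | _] = ([set x | u x < c] `&` [set x | first_pos (P x) = n]) `|`
    (~` [set x | u x < c] `&` [set x | 1%N = n])).
  apply: measurableU; apply: measurableI => //.
  - apply: measurable_first_pos => j; apply: measurable_lt_set => //.
    exact: measurable_residue_shift.
  - exact: measurableC.
  - have [<-|n1] := eqVneq 1%N n.
      by rewrite (_ : [set _ | _] = setT) //; apply/seteqP; split.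
    rewrite (_ : [set _ | _] = set0) //.
    by apply/seteqP; split => // x /= /eqP; rewrite (negbTE n1).
apply/seteqP; split => x /=; rewrite /return_time -/(P x).
  by case: ifP => xc; [left|right].
by case: ifP => xc [[]|[]].
Qed.

Lemma measurable_back_time n : borel [set x | back_time x = n].
Proof.
have mu : measurable_fun setT (u : measurableTypeR R -> measurableTypeR R).
  exact: measurable_residue.
apply: (@measurable_first_pos _ _ (fun (x : measurableTypeR R) j =>
  u (x - j%:R * beta) < Order.min (u x) c)) => j.
apply: measurable_lt_set; first exact: measurable_residue_shift.
apply: measurable_minr => //; exact: measurable_cst.
Qed.

Lemma measurable_in_tower : borel [set x | in_tower x].
Proof.
rewrite (_ : [set x | _] = \bigcup_n ([set x | back_time x = n] `&`
    [set x | 0 <= x - n%:R * beta < c])).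
  apply: bigcupT_measurable => n; apply: measurableI; first exact: measurable_back_time.
  rewrite (_ : [set x | _] = `[n%:R * beta, c + n%:R * beta[%classic).
    exact: measurable_itv.
  by apply/seteqP; split => x /=; rewrite in_itv /= subr_ge0 ltrBlDr.
apply/seteqP; split => [x xt|x [n _ [/= <-]]//].
by exists (back_time x).
Qed.

(** The value depends only on rho and on membership in E and in [0, c). Any preimage is thus a
    countable union of Borel level sets of this triple. *)
Lemma tiling_fun_measurable : lebesgue_measurable tiling_fun.
Proof.
move=> _ Y _; rewrite setTI; apply: lebesgue_measurable_borel.
pose V (z : nat * bool * bool) : R[i] :=
  (if z.1.2 then z.1.1%:R else 0) - (if z.2 then z.1.1.-1%:R else 0).
pose level (z : nat * bool * bool) : set R := if `[< Y (V z) >] then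
  [set x | return_time x = z.1.1] `&` [set x | in_tower x = z.1.2] `&`
    [set x | (0 <= x < c) = z.2] else set0.
have mbool (A : R -> bool) (b : bool) : borel [set x | A x] -> borel [set x | A x = b].
  move=> mA; case: b => //; rewrite (_ : [set x | _] = ~` [set x | A x]).
    exact: measurableC.
  by apply/seteqP; split => x /=; [move=> ->|move/negP/negbTE].
rewrite (_ : _ @^-1` Y = \bigcup_z level z).
  apply: countable_bigcupT_measurable => // z; rewrite /level; case: ifP => // _.
  apply: measurableI; first apply: measurableI.
  - exact: measurable_return_time.
  - by apply: mbool; exact: measurable_in_tower.
  - apply: mbool; rewrite (_ : [set x | _] = `[0, c[%classic) //.
apply/seteqP; split => x.
  move=> Yx; exists (return_time x, in_tower x, 0 <= x < c) => //.
  by rewrite /level ifT //; apply/asboolP.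
case=> -[[n b1] b2] _; rewrite /level; case: asboolP => //= YV [[/= rt it] ib].
by rewrite /tiling_fun rt it ib.
Qed.

(** Folding modulo alpha sends the pieces of E to disjoint subsets of [0, alpha), by the uniqueness
    in [in_tower_shift]. *)
Lemma mes_in_tower : (mes [set x | in_tower x] <= alpha%:E)%E.
Proof.
have mE := lebesgue_measurable_borel measurable_in_tower.
rewrite (mes_fold alpha0 mE).
pose A n := translate ((int_of_nat n)%:~R * alpha) [set x | in_tower x] `&`
  `[0, alpha[.
have mA n : measurable (A n : set (@lebesgueTypeR R)).
  apply: measurableI; first exact: measurable_translate.
  by apply: lebesgue_measurable_borel; exact: measurable_itv.
rewrite -(@measure_semi_bigcup _ _ _ (@completed_lebesgue_measure R) A) //;
  last 2 first.
- apply/trivIsetP => i j _ _ ij; apply/seteqP; split => // x.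
  rewrite /A /translate /= => -[[+ _] [+ _]].
  have e (z : int) : x + z%:~R * alpha = x - (- z)%:~R * alpha.
    by rewrite rmorphN mulNr opprK.
  rewrite !e !in_tower_shift => /eqP zi /eqP.
  rewrite -zi => /oppr_inj /(can_inj int_of_natK) ji.
  by rewrite ji eqxx in ij.
- exact: bigcupT_measurable.
rewrite -(mes_itv0 alpha0); apply: mes_le => x [n _]; by case.
Qed.

Lemma mes_supp_tiling_fun : (mes (supp tiling_fun) <= (alpha + c)%:E)%E.
Proof.
apply: (@le_trans _ _ (mes ([set x | in_tower x] `|` `[0%R, c[))%E).
  apply: mes_le => x; rewrite /supp /tiling_fun /= in_itv /=.
  by case: in_tower; [left|case: (0 <= x < c); [right|rewrite subr0 eqxx]].
apply: (le_trans (mesU_le _ _)).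
by rewrite EFinD mes_itv0 // leeD2r // mes_in_tower.
Qed.

End Construction.

Theorem theorem2p7 (R : realType) (alpha beta : R)
    (alpha_gt0 : 0 < alpha) (beta_gt0 : 0 < beta)
    (indep : rationally_independent alpha beta) :
  (forall eps : R, 0 < eps ->
     exists f : R -> R[i],
       [/\ lebesgue_measurable f,
           tiles_at_level f alpha 1,
           tiles_at_level f beta 0
         & (mes (supp f) < (alpha + eps)%:E)%E]) /\
  (forall f : R -> R[i],
     lebesgue_measurable f ->
     tiles_at_level f alpha 1 ->
     tiles_at_level f beta 0 ->
     (alpha%:E < mes (supp f))%E).
Proof.
split=> [eps eps0|f mf fa fb]; last exact: mes_supp_gt fb.
(* Halving [eps] gives the strict bound; the other two terms keep [0, c) inside one period of each
   lattice. *)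
pose c := Order.min (eps / 2) (Order.min alpha beta).
have c0 : 0 < c by rewrite !lt_min divr_gt0 // alpha_gt0.
have [c_eps c_alpha c_beta] : [/\ c < eps, c <= alpha & c <= beta].
  by split; rewrite /c ?gt_min ?ge_min ?lexx ?orbT // gtr_pMr ?invf_lt1 ?ltr1n.
have step (j z : int) : j != 0 -> j%:~R * beta != z%:~R * alpha.
  move=> /eqP j0; apply/eqP => e; apply: j0.
  have [|_ /eqP] := indep z (- j); first by rewrite rmorphN mulNr e subrr.
  by rewrite oppr_eq0 => /eqP.
have gen := ae_generic alpha beta.
exists (tiling_fun alpha beta c); split.
- exact: tiling_fun_measurable.
- by split; apply: (ae_mono gen) => x gx;
    have [] := tiling_fun_alpha alpha_gt0 step c0 c_alpha gx.
- by split; apply: (ae_mono gen) => x gx;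
    have [] := tiling_fun_beta alpha_gt0 beta_gt0 step c0 c_alpha c_beta gx.
- apply: (@le_lt_trans _ _ (alpha + c)%:E); last by rewrite lte_fin ltrD2l.
  exact: mes_supp_tiling_fun.
Qed.
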